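(* Let $\mathcal{E}$ be a nilpotent evolution algebra of type $[1,2,2]$ over an algebraically closed field $\mathbb{F}$ of characteristic not two, and fix $i\in\mathbb{F}$ with $i^2=-1$. Then $\mathcal{E}$ is isomorphic to one of the following evolution algebras, given by the squares of the elements of a natural basis $\{e_1,\ldots,e_5\}$ (products $e_je_k$ with $j\neq k$ are $0$), where in all cases $e_3^2=e_4^2=e_5$, $e_5^2=0$, and: - (1) $e_1^2=e_3$, $e_2^2=\alpha e_3+e_4$, with $\alpha\in\mathbb{F}$; - (2) $e_1^2=e_3$, $e_2^2=e_3$; - (3) $e_1^2=e_3$, $e_2^2=e_3+e_5$; - (4) $e_1^2=e_3+i\,e_4$, $e_2^2=e_3+i\,e_4$; - (5) $e_1^2=e_3+i\,e_4$, $e_2^2=e_3+i\,e_4+e_5$; - (6) $e_1^2=e_3+i\,e_4$, $e_2^2=e_3-i\,e_4$. Algebras in different families among (1)–(6) are not isomorphic, and two algebras in family (1) with parameters $\alpha,\alpha'$ are isomorphic if and only if $\alpha'=\alpha$ or $\alpha'=-\alpha$.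
   Context: An evolution algebra (finite-dimensional here) is an algebra $\mathcal{E}$ over $\mathbb{F}$ with a basis $\{e_1,\ldots,e_n\}$ (a natural basis) such that $e_je_k=0$ for $j\neq k$; it is automatically commutative, and need not be associative. For an algebra $\mathcal{A}$, $\mathrm{ann}(\mathcal{A})=\{x\in\mathcal{A}: x\mathcal{A}=\mathcal{A}x=0\}$, $\mathrm{ann}^0(\mathcal{A})=0$, and $\mathrm{ann}^j(\mathcal{A})$ is defined by $\mathrm{ann}^j(\mathcal{A})/\mathrm{ann}^{j-1}(\mathcal{A})=\mathrm{ann}(\mathcal{A}/\mathrm{ann}^{j-1}(\mathcal{A}))$. With $\mathcal{A}^1=\mathcal{A}$ and $\mathcal{A}^{k+1}=\sum_{j=1}^k\mathcal{A}^j\mathcal{A}^{k+1-j}$, $\mathcal{A}$ is nilpotent if $\mathcal{A}^m=0$ for some $m$, equivalently $\mathrm{ann}^r(\mathcal{A})=\mathcal{A}$ for some $r$. The type of a finite-dimensional nilpotent algebra $\mathcal{A}$ is the sequence $[n_1,\ldots,n_r]$, where $r$ is the least natural number with $\mathrm{ann}^r(\mathcal{A})=\mathcal{A}$ and $n_j=\dim\mathrm{ann}^j(\mathcal{A})-\dim\mathrm{ann}^{j-1}(\mathcal{A})$. *)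

(* Defs.v *)
From HB Require Import structures.
From mathcomp Require Import all_boot all_order all_algebra.

Set Implicit Arguments.
Unset Strict Implicit.
Unset Printing Implicit Defensive.

Import GRing.Theory.
Local Open Scope ring_scope.

(* Finite-dimensional algebras that need be neither associative, commutative
   nor unital (so mathcomp's algType and falgType do not apply).             *)
Record nalg (F : fieldType) := NAlg {
  nalg_sort :> vectType F;
  nmul : {bilinear nalg_sort -> nalg_sort -> nalg_sort}
}.

Section Algebras.
Variable F : fieldType.
Implicit Types A B : nalg F.

Definition isomorphic A B : Prop :=
  exists f : {linear A -> B},
    bijective f /\ {morph f : x y / nmul A x y >-> nmul B x y}.

Definition natural_basis A n (e : n.-tuple A) : Prop :=
  basis_of fullv e /\
  forall j k : 'I_n, j != k -> nmul A (tnth e j) (tnth e k) = 0.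

Definition evolution A : Prop :=
  exists n, exists e : n.-tuple A, natural_basis e.

Definition ann A : {vspace A} :=
  (lker (linfun (fun x => linfun (fun y => nmul A x y))) :&:
   lker (linfun (fun x => linfun (fun y => nmul A y x))))%VS.

Lemma linfun_linear (U V : vectType F) (f : U -> V) :
  linear f -> linfun f =1 f.
Proof.
move=> lf x; pose h := GRing.isLinear.Build F U V *:%R f lf.
pose g : {linear U -> V} := HB.pack f h.
exact: (lfunE g).
Qed.

Lemma annP A (x : A) :
  reflect (forall y, nmul A x y = 0 /\ nmul A y x = 0) (x \in ann A).
Proof.
have EL y : linfun (fun z => nmul A y z) =1 (fun z => nmul A y z).
  by apply: linfun_linear => a u v; rewrite linearPr.
have ER y : linfun (fun z => nmul A z y) =1 (fun z => nmul A z y).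
  by apply: linfun_linear => a u v; rewrite linearPl.
rewrite memv_cap !memv_ker !linfun_linear /=.
- apply: (iffP andP) => [[/eqP E1 /eqP E2] y | E].
    split; first by rewrite -(EL x y) E1 zero_lfunE.
    by rewrite -(ER x y) E2 zero_lfunE.
  split; apply/eqP/lfunP=> y; rewrite zero_lfunE.
    exact: etrans (EL x y) (E y).1.
  exact: etrans (ER x y) (E y).2.
- by move=> a u v; apply/lfunP=> y; rewrite add_lfunE scale_lfunE !ER linearPr.
- by move=> a u v; apply/lfunP=> y; rewrite add_lfunE scale_lfunE !EL linearPl.
Qed.

Arguments annP {A x}.

(* The quotient A / I is realised on a complement of I: quot_proj I is the
   projection of A along I onto that complement, and has kernel I.  The
   construction makes sense for any subspace I; quot_proj I is a morphism of
   algebras when I is an ideal.                                              *)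
Section Quotient.
Variables (A : nalg F) (I : {vspace A}).

Definition quot_proj (x : A) : subvs_of I^C := vsproj I^C (daddv_pi I^C I x).

Lemma quot_proj_is_linear : linear quot_proj.
Proof. by move=> a x y; rewrite /quot_proj !linearP. Qed.

HB.instance Definition _ :=
  GRing.isLinear.Build F A (subvs_of I^C) *:%R quot_proj quot_proj_is_linear.

Lemma quot_projE x : x - vsval (quot_proj x) \in I.
Proof.
have cI0 : (I^C :&: I = 0)%VS by rewrite capvC capv_compl.
rewrite vsprojK ?memv_pi // -{1}[x](daddv_pi_add cI0).
  by rewrite addrC addKr memv_pi.
by rewrite addvC addv_complf memvf.
Qed.

Lemma quot_projK : cancel vsval quot_proj.
Proof.
move=> x; rewrite /quot_proj daddv_pi_id ?vsvalK ?subvsP //.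
by rewrite capvC capv_compl.
Qed.

Lemma quot_proj_eq0 x : (quot_proj x == 0) = (x \in I).
Proof.
apply/eqP/idP=> [x0 | Ix]; first by move: (quot_projE x); rewrite x0 subr0.
have : vsval (quot_proj x) \in (I :&: I^C)%VS.
  rewrite memv_cap subvsP andbT -[vsval _](subKr x).
  by rewrite rpredB // quot_projE.
rewrite capv_compl memv0 => /eqP v0.
by rewrite -[quot_proj x]vsvalK v0 linear0.
Qed.

Definition quot_mul (x y : subvs_of I^C) : subvs_of I^C :=
  quot_proj (nmul A (vsval x) (vsval y)).

Lemma quot_mul_is_bilinear : bilinear_for *:%R *:%R quot_mul.
Proof.
split=> u a x y; rewrite /quot_mul.
  by rewrite !linearP linearPl linearP.
by rewrite !linearP.
Qed.

HB.instance Definition _ := bilinear_isBilinear.Build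
  F (subvs_of I^C) (subvs_of I^C) (subvs_of I^C) *:%R *:%R
  quot_mul quot_mul_is_bilinear.

Definition quot_alg : nalg F := NAlg quot_mul.

Lemma quot_projM :
  (forall x y, x \in I -> nmul A x y \in I /\ nmul A y x \in I) ->
  {morph quot_proj : x y / nmul A x y >-> nmul quot_alg x y}.
Proof.
move=> idI x y; apply/eqP; rewrite /= /quot_mul -subr_eq0 -linearB quot_proj_eq0.
set x' := vsval _; set y' := vsval _.
have -> : nmul A x y - nmul A x' y' = nmul A (x - x') y + nmul A x' (y - y').
  by rewrite linearBl linearBr addrA subrK.
by rewrite rpredD //; [case: (idI _ y (quot_projE x)) | case: (idI _ x' (quot_projE y))].
Qed.

End Quotient.

(* ann_series A j is ann^j(A). *)
Fixpoint ann_series A j : {vspace A} :=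
  if j is j'.+1 then
    (linfun (quot_proj (ann_series A j')) @^-1:
       (ann (quot_alg (ann_series A j')) : {vspace subvs_of _}))%VS
  else 0%VS.

Lemma ann_series_spec A j :
  (forall x y : A, x \in ann_series A j ->
     nmul A x y \in ann_series A j /\ nmul A y x \in ann_series A j) /\
  (forall x : A, x \in ann_series A j.+1 <->
     forall y, nmul A x y \in ann_series A j /\ nmul A y x \in ann_series A j).
Proof.
have step k : (forall x y : A, x \in ann_series A k ->
     nmul A x y \in ann_series A k /\ nmul A y x \in ann_series A k) ->
  (forall x : A, x \in ann_series A k.+1 <->
     forall y, nmul A x y \in ann_series A k /\ nmul A y x \in ann_series A k).
  move=> idk x; have morph := quot_projM idk.
  rewrite /= -memv_preim lfunE.
  set I := ann_series A k in idk morph *.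
  have annI := @annP (quot_alg I) (quot_proj I x).
  split=> [xI y | sx].
    have [] := elimT annI xI (quot_proj I y).
    by rewrite -!morph => /eqP + /eqP; rewrite !quot_proj_eq0.
  apply: (introT annI) => y; rewrite -[y]quot_projK -!morph.
  by case: (sx (vsval y)) => s1 s2; split; apply/eqP; rewrite quot_proj_eq0.
suff idj : forall x y : A, x \in ann_series A j ->
    nmul A x y \in ann_series A j /\ nmul A y x \in ann_series A j.
  by split=> //; apply: step.
elim: j => [|j IHj] x y; first by rewrite memv0 => /eqP->; rewrite linear0l linear0r mem0v.
have sj := step _ IHj; move=> /sj sx; have [xy yx] := sx y.
by split; apply/sj=> z; apply: IHj.
Qed.

Lemma ann_seriesP A j (x : A) :
  x \in ann_series A j.+1 <->
  forall y, nmul A x y \in ann_series A j /\ nmul A y x \in ann_series A j.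
Proof. by have [_] := ann_series_spec A j; apply. Qed.

Lemma ann_seriesS A j : (ann_series A j <= ann_series A j.+1)%VS.
Proof.
by apply/subvP=> x xj; apply/ann_seriesP=> y; have [+ _] := ann_series_spec A j; apply.
Qed.

Definition alg_prodv A (U V : {vspace A}) : {vspace A} :=
  <<[seq nmul A x y | x <- vbasis U, y <- vbasis V]>>%VS.

Lemma alg_prodvP A (U V W : {vspace A}) :
  reflect (forall x y, x \in U -> y \in V -> nmul A x y \in W)
          (alg_prodv U V <= W)%VS.
Proof.
apply: (iffP idP) => [sUVW x y Ux Vy | sUVW].
  rewrite (coord_vbasis Ux) (coord_vbasis Vy) linear_sumlz rpred_sum // => j _.
  rewrite linear_sumr rpred_sum // => k _.
  rewrite linearZl_LR linearZr_LR !rpredZ // (subvP sUVW) // memv_span //.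
  by apply: allpairs_f; rewrite mem_nth ?size_tuple.
apply/span_subvP=> _ /allpairsP[[x y] /= [Ux Vy ->]].
by apply: sUVW; apply: vbasis_mem.
Qed.

(* alg_powers A k = [:: A^1; ...; A^(k+1)] *)
Fixpoint alg_powers A k : seq {vspace A} :=
  if k is k'.+1 then
    let s := alg_powers A k' in
    rcons s (\sum_(j < k) alg_prodv (nth 0 s j) (nth 0 s (k' - j)%N))%VS
  else [:: fullv].

(* A^k for k >= 1; the value at k = 0 is never used. *)
Definition alg_power A k : {vspace A} := nth 0%VS (alg_powers A k.-1) k.-1.

Lemma size_alg_powers A k : size (alg_powers A k) = k.+1.
Proof. by elim: k => //= k IHk; rewrite size_rcons IHk. Qed.

Lemma nth_alg_powers A k j :
  (j <= k)%N -> nth 0%VS (alg_powers A k) j = alg_power A j.+1.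
Proof.
elim: k => [|k IHk]; first by rewrite leqn0 => /eqP->.
rewrite leq_eqVlt => /predU1P[-> // | lt_jk].
by rewrite /= nth_rcons size_alg_powers lt_jk IHk.
Qed.

Lemma alg_power1 A : alg_power A 1 = fullv.
Proof. by []. Qed.

Lemma alg_powerS A k : (0 < k)%N ->
  alg_power A k.+1 =
  (\sum_(1 <= j < k.+1) alg_prodv (alg_power A j) (alg_power A (k.+1 - j)%N))%VS.
Proof.
case: k => // k _; rewrite big_add1 big_mkord.
rewrite {1}/alg_power [alg_powers _ _]/= nth_rcons size_alg_powers ltnn eqxx.
apply: eq_bigr => j _; have lejk : (j <= k)%N by rewrite -ltnS.
by rewrite !nth_alg_powers ?leq_subr // subSS subSn.
Qed.

Definition nilpotent A : Prop := exists2 m, (0 < m)%N & alg_power A m = 0%VS.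

(* The subtraction is not truncated, by ann_seriesS. *)
Definition has_type A (s : seq nat) : Prop :=
  [/\ ann_series A (size s) = fullv,
      forall r, ann_series A r = fullv -> (size s <= r)%N &
      forall j, (j < size s)%N ->
        nth 0%N s j = (\dim (ann_series A j.+1) - \dim (ann_series A j))%N].

(* The algebra on 'rV[F]_n in which the standard basis is natural and its k-th
   element has square sq k.                                                   *)
Section EvolutionAlgebraOfSquares.
Variables (n : nat) (sq : 'I_n -> 'rV[F]_n).

Definition evol_mul (x y : 'rV[F]_n) : 'rV[F]_n :=
  \sum_k (x 0 k * y 0 k) *: sq k.

Lemma evol_mul_is_bilinear : bilinear_for *:%R *:%R evol_mul.
Proof.
split=> u a x y; rewrite /= /evol_mul scaler_sumr -big_split /=;
  apply: eq_bigr => k _; rewrite scalerA -scalerDl !mxE.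
  by rewrite mulrDl mulrA.
by rewrite mulrDr mulrCA.
Qed.

HB.instance Definition _ := bilinear_isBilinear.Build
  F 'rV[F]_n 'rV[F]_n 'rV[F]_n *:%R *:%R evol_mul evol_mul_is_bilinear.

Definition evol_alg : nalg F := NAlg evol_mul.

Lemma evol_mul_delta j k :
  evol_mul (delta_mx 0 j) (delta_mx 0 k) = if j == k then sq j else 0.
Proof.
rewrite /evol_mul (bigD1 j) //= big1 => [|l lj].
  by rewrite !mxE !eqxx mul1r addr0; case: eqP; rewrite ?scale1r ?scale0r.
by rewrite !mxE (negPf lj) mul0r scale0r.
Qed.

End EvolutionAlgebraOfSquares.

End Algebras.

Section Models.
Variables (F : fieldType) (i : F).

(* Labels of the six families; only the first one has a parameter. *)
Inductive model :=
  Model1 of F | Model2 | Model3 | Model4 | Model5 | Model6.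

Definition model_family (m : model) : nat :=
  match m with
  | Model1 _ => 1 | Model2 => 2 | Model3 => 3
  | Model4 => 4 | Model5 => 5 | Model6 => 6
  end.

(* e_1, ..., e_5, numbered from 1. *)
Definition e_ (k : nat) : 'rV[F]_5 := \row_(j < 5) (j.+1 == k)%:R.

Lemma e_delta (k : 'I_5) : e_ k.+1 = delta_mx 0 k.
Proof. by apply/rowP=> j; rewrite !mxE eqSS. Qed.

Definition sq1 (m : model) : 'rV[F]_5 :=
  match m with
  | Model1 _ | Model2 | Model3 => e_ 3
  | Model4 | Model5 | Model6 => e_ 3 + i *: e_ 4
  end.

Definition sq2 (m : model) : 'rV[F]_5 :=
  match m with
  | Model1 a => a *: e_ 3 + e_ 4
  | Model2 => e_ 3
  | Model3 => e_ 3 + e_ 5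
  | Model4 => e_ 3 + i *: e_ 4
  | Model5 => e_ 3 + i *: e_ 4 + e_ 5
  | Model6 => e_ 3 - i *: e_ 4
  end.

Definition model_sq (m : model) (k : 'I_5) : 'rV[F]_5 :=
  nth 0 [:: sq1 m; sq2 m; e_ 5; e_ 5; 0] k.

Definition model_alg (m : model) : nalg F := evol_alg (model_sq m).

End Models.

Arguments Model2 {F}.
Arguments Model3 {F}.
Arguments Model4 {F}.
Arguments Model5 {F}.
Arguments Model6 {F}.

(* Main.v *)
Require Import Defs.
From HB Require Import structures.
From mathcomp Require Import all_boot all_order all_algebra.
From mathcomp Require Import ring zify.

Set Implicit Arguments.
Unset Strict Implicit.
Unset Printing Implicit Defensive.

Import GRing.Theory.
Local Open Scope ring_scope.

(* The span of those elements of a natural basis that lie in [ann^j] is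
   [ann^j] itself, so type [1,2,2] provides a natural basis v1, v2, w1, w2, z
   with [z^2 = 0], [w1^2], [w2^2] nonzero multiples of z (rescaled to z), and
   [v1^2], [v2^2] vectors p, q of <w1, w2, z> that are nonzero modulo z.
   Multiplication induces on <w1, w2> = ann^2 / ann the quadratic form
   x^2 + y^2, and isomorphisms act on the pair (p, q) by its similitudes,
   by shears along z, and by rescaling and (possibly) mixing v1 and v2.  The
   families correspond to p, q being independent (1, 6) or proportional (2-5)
   modulo z, to which of them are isotropic, and, in the proportional case, to
   whether v1 and v2 can be scaled to have the same square.  In family (1),
   [alpha^2] is the invariant [(p.q)^2 / det(p, q)^2]. *)

(** * Isomorphisms, and presentation of an algebra by the squares of a natural basis *)

Section Isomorphisms.
Variable F : fieldType.
Implicit Types A B C : nalg F.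

Lemma isomorphic_sym A B : isomorphic A B -> isomorphic B A.
Proof.
case=> f [[g fK gK] fM].
have lg : linear g by exact: can2_linear fK gK.
pose h := GRing.isLinear.Build F B A *:%R g lg.
pose g' : {linear B -> A} := HB.pack g h.
exists g'; split; first by exists f.
by move=> x y; apply: (can_inj fK); rewrite fM /= !gK.
Qed.

Lemma isomorphic_trans B A C :
  isomorphic A B -> isomorphic B C -> isomorphic A C.
Proof.
case=> f [bf fM] [g [bg gM]]; exists (g \o f).
by split=> [|x y]; [apply: bij_comp | rewrite /= fM gM].
Qed.

Lemma inj_linear_bij (V : vectType F) (f : {linear V -> V}) :
  injective f -> bijective f.
Proof.
move=> injf; have kf : lker (linfun f) == 0%VS.
  by apply/lker0P=> x y; rewrite !lfunE => /injf.
exists (linfun f)^-1%VF => x.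
  by rewrite -[f x]lfunE lker0_lfunK.
by rewrite -[LHS]lfunE lker0_lfunVK.
Qed.

(** The isomorphism is the coordinate map of [b]: orthogonality leaves only the diagonal terms in a
    product. *)
Lemma iso_of_squares A n (b : n.-tuple A) (sq : 'I_n -> 'rV[F]_n) :
  natural_basis b ->
  (forall j, nmul A (tnth b j) (tnth b j) = \sum_k sq j 0 k *: tnth b k) ->
  isomorphic A (evol_alg sq).
Proof.
case=> bb orth sqb; have fb := basis_free bb.
have bE x : x = \sum_k coord b k x *: tnth b k.
  rewrite {1}(@coord_basis _ _ _ _ b x bb (memvf x)).
  by apply: eq_bigr => k _; rewrite (tnth_nth 0).
pose f x : 'rV[F]_n := \row_k coord b k x.
have lf : linear f by move=> a x y; apply/rowP=> k; rewrite !mxE linearP.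
pose h := GRing.isLinear.Build F A 'rV[F]_n *:%R f lf.
pose f' : {linear A -> evol_alg sq} := HB.pack (f : A -> evol_alg sq) h.
exists f'; split.
  exists (fun y : 'rV[F]_n => \sum_k y 0 k *: tnth b k) => [x | y].
    by rewrite [RHS]bE; apply: eq_bigr => k _; rewrite mxE.
  apply/rowP=> k; rewrite /= mxE; under eq_bigr do rewrite (tnth_nth 0).
  by rewrite coord_sum_free.
move=> x y; rewrite /= /evol_mul.
have -> : nmul A x y =
    \sum_j (coord b j x * coord b j y) *: nmul A (tnth b j) (tnth b j).
  rewrite {1}[x]bE linear_sumlz; apply: eq_bigr => j _.
  rewrite linearZl_LR {1}[y]bE linear_sumr (bigD1 j) //= big1 => [|k kj].
    by rewrite addr0 linearZr_LR scalerA.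
  by rewrite linearZr_LR orth ?scaler0 // eq_sym.
apply/rowP=> k; rewrite mxE summxE linear_sum; apply: eq_bigr => j _.
rewrite linearZ /= !mxE; congr (_ * _); rewrite sqb.
by under eq_bigr do rewrite (tnth_nth 0); rewrite coord_sum_free.
Qed.

End Isomorphisms.

(** * Coordinates in dimension five and the normal form for type [1,2,2] *)

Section Coordinates.
Variable F : fieldType.
Implicit Types (x : 'rV[F]_5).

Definition v5 (a b c d e : F) : 'rV[F]_5 := \row_(j < 5) nth 0 [:: a; b; c; d; e] j.

Lemma v5P x : exists a b c d e, x = v5 a b c d e.
Proof.
exists (x 0 (inord 0)), (x 0 (inord 1)), (x 0 (inord 2)), (x 0 (inord 3)),
  (x 0 (inord 4)); apply/rowP=> j; rewrite mxE.
by case: j => [[|[|[|[|[|j]]]]] ltj] //=; congr (x _ _); apply: val_inj; rewrite /= inordK.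
Qed.

Lemma v5_inj a b c d e a' b' c' d' e' :
  v5 a b c d e = v5 a' b' c' d' e' ->
  [/\ a = a', b = b', c = c', d = d' & e = e'].
Proof.
move=> /rowP E.
split; [move: (E (inord 0)) | move: (E (inord 1)) | move: (E (inord 2))
       | move: (E (inord 3)) | move: (E (inord 4))]; by rewrite !mxE inordK.
Qed.

Lemma v5D a b c d e a' b' c' d' e' :
  v5 a b c d e + v5 a' b' c' d' e' =
  v5 (a + a') (b + b') (c + c') (d + d') (e + e').
Proof.
by apply/rowP=> -[[|[|[|[|[|j]]]]] ltj]; rewrite !mxE.
Qed.

Lemma v5Z k a b c d e :
  k *: v5 a b c d e = v5 (k * a) (k * b) (k * c) (k * d) (k * e).
Proof. by apply/rowP=> -[[|[|[|[|[|j]]]]] ltj]; rewrite !mxE. Qed.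

Lemma v5_0 : v5 0 0 0 0 0 = 0.
Proof. by apply/rowP=> -[[|[|[|[|[|j]]]]] ltj]; rewrite !mxE. Qed.

Lemma e_v5 k : e_ F k = v5 (1 == k)%N%:R (2 == k)%N%:R (3 == k)%N%:R (4 == k)%N%:R (5 == k)%N%:R.
Proof. by apply/rowP=> -[[|[|[|[|[|j]]]]] ltj]; rewrite !mxE. Qed.

(** Common shape of the six families and, over a closed field, of every algebra of type [1,2,2] once
    [w1] and [w2] are rescaled. *)
Definition type122_alg (p q : 'rV[F]_5) : nalg F :=
  evol_alg (fun k => nth 0 [:: p; q; e_ F 5; e_ F 5; 0] k).

Lemma type122_mul p1 p2 p3 q1 q2 q3 a b c d e a' b' c' d' e' :
  nmul (type122_alg (v5 0 0 p1 p2 p3) (v5 0 0 q1 q2 q3))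
    (v5 a b c d e) (v5 a' b' c' d' e') =
  v5 0 0 (a * a' * p1 + b * b' * q1) (a * a' * p2 + b * b' * q2)
    (a * a' * p3 + b * b' * q3 + c * c' + d * d').
Proof.
rewrite /= /evol_mul !big_ord_recl big_ord0 /= !mxE /= e_v5 /= -v5_0 !v5Z !v5D.
by congr v5; ring.
Qed.

End Coordinates.

(** * Isomorphisms between normal forms as systems of equations *)

Section Change.
Variable F : fieldType.

(* The change of basis e1 |-> a e1 + b e2, e2 |-> c e1 + d e2,
   e3 |-> m e3 + n e4 + s e5, e4 |-> m' e3 + n' e4 + s' e5, e5 |-> k e5. *)
Definition change_eqs (p1 p2 p3 q1 q2 q3 p1' p2' p3' q1' q2' q3'
    a b c d m n s m' n' s' k : F) : Prop :=
  [/\ [/\ a * d - b * c != 0, k != 0, m * m + n * n = k,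
          m' * m' + n' * n' = k & m * m' + n * n' = 0],
      [/\ a * c * p1' + b * d * q1' = 0, a * c * p2' + b * d * q2' = 0 &
          a * c * p3' + b * d * q3' = 0],
      [/\ p1 * m + p2 * m' = a * a * p1' + b * b * q1',
          p1 * n + p2 * n' = a * a * p2' + b * b * q2' &
          p1 * s + p2 * s' + p3 * k = a * a * p3' + b * b * q3'] &
      [/\ q1 * m + q2 * m' = c * c * p1' + d * d * q1',
          q1 * n + q2 * n' = c * c * p2' + d * d * q2' &
          q1 * s + q2 * s' + q3 * k = c * c * p3' + d * d * q3']].

(** The equations express multiplicativity on pairs of basis vectors. The map is injective since its
    block on e1, e2 has nonzero determinant and its block M on e3, e4 satisfies M M^T = k I with [k]
    nonzero. *)
Lemma change_iso p1 p2 p3 q1 q2 q3 p1' p2' p3' q1' q2' q3'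
    a b c d m n s m' n' s' k :
  change_eqs p1 p2 p3 q1 q2 q3 p1' p2' p3' q1' q2' q3'
    a b c d m n s m' n' s' k ->
  isomorphic (type122_alg (v5 0 0 p1 p2 p3) (v5 0 0 q1 q2 q3))
    (type122_alg (v5 0 0 p1' p2' p3') (v5 0 0 q1' q2' q3')).
Proof.
case=> -[det0 k0 mm mm' mn] [o1 o2 o3] [P1 P2 P3] [Q1 Q2 Q3].
pose X (x : 'rV[F]_5) j := x 0 (inord j).
pose f (x : 'rV[F]_5) : 'rV[F]_5 :=
  v5 (X x 0%N * a + X x 1%N * c) (X x 0%N * b + X x 1%N * d)
     (X x 2%N * m + X x 3%N * m') (X x 2%N * n + X x 3%N * n')
     (X x 2%N * s + X x 3%N * s' + X x 4%N * k).
have lf : linear f.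
  by move=> t x y; rewrite /f v5Z v5D /X !mxE; congr v5; ring.
have fE x1 x2 x3 x4 x5 : f (v5 x1 x2 x3 x4 x5) =
  v5 (x1 * a + x2 * c) (x1 * b + x2 * d) (x3 * m + x4 * m')
     (x3 * n + x4 * n') (x3 * s + x4 * s' + x5 * k).
  by rewrite /f /X !mxE !inordK.
pose h := GRing.isLinear.Build F 'rV[F]_5 'rV[F]_5 *:%R f lf.
pose f' : {linear 'rV[F]_5 -> 'rV[F]_5} := HB.pack f h.
have injf : injective f'.
  apply: raddf_inj => x; have [x1 [x2 [x3 [x4 [x5 ->]]]]] := v5P x.
  rewrite /= fE -v5_0 => /v5_inj [E1 E2 E3 E4 E5].
  have z (t r : F) : r != 0 -> t * r = 0 -> t = 0.
    by move=> r0 /eqP; rewrite mulf_eq0 (negPf r0) orbF => /eqP.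
  have x10 : x1 = 0.
    apply: (z _ _ det0).
    transitivity (d * (x1 * a + x2 * c) - c * (x1 * b + x2 * d)); first by ring.
    by rewrite E1 E2; ring.
  have x20 : x2 = 0.
    apply: (z _ _ det0).
    transitivity (a * (x1 * b + x2 * d) - b * (x1 * a + x2 * c)); first by ring.
    by rewrite E1 E2; ring.
  have x30 : x3 = 0.
    apply: (z _ _ k0).
    transitivity (m * (x3 * m + x4 * m') + n * (x3 * n + x4 * n') -
                  x4 * (m * m' + n * n')).
      by rewrite -mm; ring.
    by rewrite E3 E4 mn; ring.
  have x40 : x4 = 0.
    apply: (z _ _ k0).
    transitivity (m' * (x3 * m + x4 * m') + n' * (x3 * n + x4 * n') -
                  x3 * (m * m' + n * n')).
      by rewrite -mm'; ring.
    by rewrite E3 E4 mn; ring.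
  have x50 : x5 = 0 by apply: (z _ _ k0); rewrite -E5 x30 x40; ring.
  by rewrite x10 x20 x30 x40 x50 v5_0.
exists (f' : {linear type122_alg _ _ -> type122_alg _ _}); split.
  exact: inj_linear_bij injf.
move=> x y; have [x1 [x2 [x3 [x4 [x5 ->]]]]] := v5P x.
have [y1 [y2 [y3 [y4 [y5 ->]]]]] := v5P y.
rewrite type122_mul [LHS]fE [f' (v5 x1 _ _ _ _)]fE [f' (v5 y1 _ _ _ _)]fE type122_mul.
(* Separates the contributions of e1^2, of e2^2 and of the mixed terms; the latter vanish because
   the images of e1 and e2 have product 0. *)
have R1 u v w : (x1 * a + x2 * c) * (y1 * a + y2 * c) * u +
    (x1 * b + x2 * d) * (y1 * b + y2 * d) * v + w
  = x1 * y1 * (a * a * u + b * b * v) + x2 * y2 * (c * c * u + d * d * v)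
   + (x1 * y2 + x2 * y1) * (a * c * u + b * d * v) + w by ring.
congr v5; try ring.
- by rewrite -[RHS]addr0 R1 o1 -P1 -Q1; ring.
- by rewrite -[RHS]addr0 R1 o2 -P2 -Q2; ring.
rewrite -[RHS]addrA R1 o3 -P3 -Q3.
have -> : (x3 * m + x4 * m') * (y3 * m + y4 * m') +
    (x3 * n + x4 * n') * (y3 * n + y4 * n')
  = x3 * y3 * (m * m + n * n) + x4 * y4 * (m' * m' + n' * n')
    + (x3 * y4 + x4 * y3) * (m * m' + n * n') by ring.
by rewrite mm mm' mn; ring.
Qed.

(** The hypotheses make the spans of e5 and of e3, e4, e5 the first two annihilators of the target.
    So e5 maps into the first, e3 and e4 into the second, and the equations are read off from
    products of basis vectors. *)
Lemma iso_change (p1 p2 p3 q1 q2 q3 p1' p2' p3' q1' q2' q3' : F) :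
  (p1' != 0) || (p2' != 0) -> (q1' != 0) || (q2' != 0) ->
  isomorphic (type122_alg (v5 0 0 p1 p2 p3) (v5 0 0 q1 q2 q3))
    (type122_alg (v5 0 0 p1' p2' p3') (v5 0 0 q1' q2' q3')) ->
  exists a b c d m n s m' n' s' k : F,
    change_eqs p1 p2 p3 q1 q2 q3 p1' p2' p3' q1' q2' q3'
      a b c d m n s m' n' s' k.
Proof.
move=> p'0 q'0 [f [bf fM]]; have injf := bij_inj bf.
set A := type122_alg _ _ in f bf fM injf; set B := type122_alg _ _ in f bf fM injf.
have cancel (x1 x2 t : F) : (x1 != 0) || (x2 != 0) -> t * x1 = 0 -> t * x2 = 0 -> t = 0.
  move=> x0 /eqP + /eqP; rewrite !mulf_eq0.
  by case: (t =P 0) x0 => //= _ /orP[]/negPf->.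
pose e1 : A := v5 1 0 0 0 0; pose e2 : A := v5 0 1 0 0 0; pose e3 : A := v5 0 0 1 0 0.
pose e4 : A := v5 0 0 0 1 0; pose e5 : A := v5 0 0 0 0 1.
have surj (y : B) : exists x : A, f x = y by case: bf => g _ gK; exists (g y).
have f0 : f (v5 0 0 0 0 0) = v5 0 0 0 0 0 :> 'rV_5.
  by rewrite v5_0 linear0.
(* The image of e5 annihilates the target; its products with e1, ..., e4 kill its first four
   coordinates. *)
have [k fe5] : exists k : F, f e5 = v5 0 0 0 0 k.
  have [x1 [x2 [x3 [x4 [k E]]]]] := v5P (f e5); exists k.
  have ann5 (y : B) : nmul B (v5 x1 x2 x3 x4 k) y = 0.
    have [x <-] := surj y; rewrite -E -fM.
    have [y1 [y2 [y3 [y4 [y5 ->]]]]] := v5P x.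
    by rewrite type122_mul !mul0r !addr0 f0 v5_0.
  move: (ann5 (v5 1 0 0 0 0)) (ann5 (v5 0 1 0 0 0)) (ann5 (v5 0 0 1 0 0)) (ann5 (v5 0 0 0 1 0)).
  rewrite !type122_mul !(mulr0, mulr1, mul0r, addr0, add0r) -v5_0.
  move=> /v5_inj[_ _ E1 E2 _] /v5_inj[_ _ E3 E4 _] /v5_inj[_ _ _ _ E5] /v5_inj[_ _ _ _ E6].
  by rewrite E E5 E6 (cancel _ _ _ p'0 E1 E2) (cancel _ _ _ q'0 E3 E4).
(* To be applied to e3 and e4, which multiply everything into the line of e5. *)
have ann2 (z : A) : (forall y, exists t : F, nmul A z y = v5 0 0 0 0 t) ->
    exists m n s : F, f z = v5 0 0 m n s.
  move=> zA; have [x1 [x2 [m [n [s E]]]]] := v5P (f z); exists m, n, s.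
  have ann5 (y : B) : exists t : F, nmul B (v5 x1 x2 m n s) y = v5 0 0 0 0 t.
    have [x <-] := surj y; rewrite -E -fM.
    have [t ->] := zA x; exists (t * k).
    have -> : v5 0 0 0 0 t = t *: e5 :> A by rewrite v5Z !mulr0 mulr1.
    by rewrite linearZ /= fe5 v5Z !mulr0.
  case: (ann5 (v5 1 0 0 0 0)) (ann5 (v5 0 1 0 0 0)) => t1 + [t2].
  rewrite !type122_mul !(mulr0, mulr1, mul0r, addr0, add0r).
  move=> /v5_inj[_ _ E1 E2 _] /v5_inj[_ _ E3 E4 _].
  by rewrite E (cancel _ _ _ p'0 E1 E2) (cancel _ _ _ q'0 E3 E4).
have [|m [n [s fe3]]] := ann2 e3.
  move=> x; have [y1 [y2 [y3 [y4 [y5 ->]]]]] := v5P x; exists y3.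
  by rewrite type122_mul; congr v5; ring.
have [|m' [n' [s' fe4]]] := ann2 e4.
  move=> x; have [y1 [y2 [y3 [y4 [y5 ->]]]]] := v5P x; exists y4.
  by rewrite type122_mul; congr v5; ring.
have [a [b [x3 [x4 [x5 fe1]]]]] := v5P (f e1).
have [c [d [y3 [y4 [y5 fe2]]]]] := v5P (f e2).
have fE z1 z2 z3 z4 z5 : f (v5 z1 z2 z3 z4 z5) =
  v5 (z1 * a + z2 * c) (z1 * b + z2 * d) (z1 * x3 + z2 * y3 + z3 * m + z4 * m')
    (z1 * x4 + z2 * y4 + z3 * n + z4 * n')
    (z1 * x5 + z2 * y5 + z3 * s + z4 * s' + z5 * k).
  have -> : v5 z1 z2 z3 z4 z5 = z1 *: e1 + z2 *: e2 + z3 *: e3 + z4 *: e4 + z5 *: e5 :> A.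
    by rewrite !v5Z !v5D; congr v5; ring.
  rewrite !linearD !linearZ /= fe1 fe2 fe3 fe4 fe5 !v5Z !v5D; congr v5; ring.
have k0 : k != 0.
  apply/eqP=> k0; have: e5 = 0 by apply: injf; rewrite linear0 fe5 k0 v5_0.
  by rewrite -v5_0 => /v5_inj[_ _ _ _ /eqP]; rewrite oner_eq0.
have M x y := fM x y; clear surj ann2 bf.
have := M e1 e2; have := M e1 e1; have := M e2 e2; have := M e3 e3.
have := M e3 e4; have := M e4 e4; have := M e1 e3; have := M e1 e4.
have := M e2 e3; have := M e2 e4.
rewrite !type122_mul !fE !type122_mul !(mulr0, mulr1, mul1r, mul0r, addr0, add0r).
move=> /v5_inj[_ _ _ _ M24] /v5_inj[_ _ _ _ M23] /v5_inj[_ _ _ _ M14].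
move=> /v5_inj[_ _ _ _ M13] /v5_inj[_ _ _ _ M44] /v5_inj[_ _ _ _ M34].
move=> /v5_inj[_ _ _ _ M33] /v5_inj[_ _ Q1 Q2 Q3] /v5_inj[_ _ P1 P2 P3].
move=> /v5_inj[_ _ O1 O2 O3].
(* Lagrange's identity: the product of the norms of (m, n) and (m', n') is the squared determinant
   plus the squared inner product, and e3 e4 = 0 makes the latter zero. *)
have det0 : (m * n' - n * m') != 0.
  apply/eqP=> d0; have /eqP : k * k = 0; last by rewrite mulf_eq0 (negPf k0).
  rewrite {1}M33 M44; transitivity ((m * n' - n * m') ^+ 2 + (m * m' + n * n') ^+ 2); first by ring.
  by rewrite d0 -M34; ring.
have sol (u v : F) : 0 = u * m + v * n -> 0 = u * m' + v * n' -> u = 0 /\ v = 0.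
  move=> E1 E2; split; apply: (mulIf det0); rewrite mul0r.
    transitivity ((u * m + v * n) * n' - (u * m' + v * n') * n); first by ring.
    by rewrite -E1 -E2; ring.
  transitivity ((u * m' + v * n') * m - (u * m + v * n) * m'); first by ring.
  by rewrite -E1 -E2; ring.
(* Since e1 and e2 are orthogonal to e3 and e4, their images have no component along e3 or e4. *)
have [x30 x40] := sol _ _ M13 M14; have [y30 y40] := sol _ _ M23 M24.
exists a, b, c, d, m, n, s, m', n', s', k; split.
- split=> //; apply/eqP=> d0.
  (* A linear relation between (a, b) and (c, d) gives a combination of e1, e2, corrected along e5,
     that [f] sends to 0. *)
  have ker (z1 z2 : F) : z1 * a + z2 * c = 0 -> z1 * b + z2 * d = 0 -> z1 = 0 /\ z2 = 0.
    move=> Ea Eb.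
    have : v5 z1 z2 0 0 (- (z1 * x5 + z2 * y5) / k) = 0 :> A.
      apply: injf; rewrite linear0 fE Ea Eb -v5_0 x30 x40 y30 y40.
      congr v5; try by ring.
      by rewrite divfK //; ring.
    by rewrite -v5_0 => /v5_inj[].
  have [||] := ker d (- b); [by rewrite -[RHS]d0; ring | by ring |].
  move=> d00 /eqP; rewrite oppr_eq0 => /eqP b00.
  have [||] := ker c (- a); [by ring|by rewrite -[RHS]oppr0 -d0; ring|].
  move=> c00 /eqP; rewrite oppr_eq0 => /eqP a00.
  have [||/eqP] := ker 1 0; try by rewrite ?a00 ?b00; ring.
  by rewrite oner_eq0.
- by split; rewrite // [RHS]O3 x30 x40; ring.
- by rewrite P1 P2 P3 x30 x40; split=> //; ring.
by rewrite Q1 Q2 Q3 y30 y40; split=> //; ring.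
Qed.
End Change.

(** * Square roots, and the six models in normal form *)

Lemma closed_sqrt (F : closedFieldType) (x : F) : exists s : F, s * s = x.
Proof.
have [s] := @solve_monicpoly F 2 (fun j => if j is 0%N then x else 0) isT.
rewrite !big_ord_recl big_ord0 /= expr0 mulr1 mul0r !addr0 => E.
by exists s; rewrite -E expr2.
Qed.

Section ModelCoordinates.
Variables (F : fieldType) (i : F).

Lemma model1E a : model_alg i (Model1 a) = type122_alg (v5 0 0 1 0 0) (v5 0 0 a 1 0).
Proof. by congr type122_alg; rewrite /= !e_v5 ?v5Z ?v5D //=; congr v5; ring. Qed.
Lemma model2E : model_alg i Model2 = type122_alg (v5 0 0 1 0 0) (v5 0 0 1 0 0).
Proof. by congr type122_alg; rewrite /= !e_v5. Qed.
Lemma model3E : model_alg i Model3 = type122_alg (v5 0 0 1 0 0) (v5 0 0 1 0 1).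
Proof. by congr type122_alg; rewrite /= !e_v5 ?v5D //=; congr v5; ring. Qed.
Lemma model4E : model_alg i Model4 = type122_alg (v5 0 0 1 i 0) (v5 0 0 1 i 0).
Proof. by congr type122_alg; rewrite /= !e_v5 ?v5Z ?v5D //=; congr v5; ring. Qed.
Lemma model5E : model_alg i Model5 = type122_alg (v5 0 0 1 i 0) (v5 0 0 1 i 1).
Proof. by congr type122_alg; rewrite /= !e_v5 ?v5Z ?v5D //=; congr v5; ring. Qed.
Lemma model6E : model_alg i Model6 = type122_alg (v5 0 0 1 i 0) (v5 0 0 1 (- i) 0).
Proof. by congr type122_alg; rewrite /= !e_v5 -?scaleNr ?v5Z ?v5D //=; congr v5; ring. Qed.

Definition model_coord := (model1E, model2E, model3E, model4E, model5E, model6E).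

End ModelCoordinates.

(** * Every normal form is isomorphic to a model *)

Section Classify.
Variables (F : closedFieldType) (i : F).
Hypotheses (char2 : 2%N \notin [pchar F]) (i2 : i ^+ 2 = -1).

Let two0 : 2%:R != 0 :> F.
Proof. by move: char2; rewrite inE. Qed.

Let ii : i * i = -1. Proof. by rewrite -expr2. Qed.

Let i0 : i != 0.
Proof. by apply/eqP=> i0; move/eqP: ii; rewrite i0 mul0r eq_sym oppr_eq0 oner_eq0. Qed.

Lemma type122_swap (p1 p2 p3 q1 q2 q3 : F) :
  isomorphic (type122_alg (v5 0 0 p1 p2 p3) (v5 0 0 q1 q2 q3))
    (type122_alg (v5 0 0 q1 q2 q3) (v5 0 0 p1 p2 p3)).
Proof.
apply: (@change_iso _ _ _ _ _ _ _ _ _ _ _ _ _ 0 1 1 0 1 0 0 0 1 0 1).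
split; split; try ring; rewrite ?oner_eq0 //.
by rewrite mul0r sub0r mulr1 oppr_eq0 oner_eq0.
Qed.

Lemma isotropicP (x y : F) : x ^+ 2 + y ^+ 2 = 0 -> y = i * x \/ y = - (i * x).
Proof.
move=> E; have /eqP : (y - i * x) * (y + i * x) = 0.
  by transitivity (y ^+ 2 - i ^+ 2 * x ^+ 2); [ring | rewrite i2 -E; ring].
rewrite mulf_eq0 => /orP[]; [left | right]; apply/eqP.
  by rewrite -subr_eq0.
by rewrite -subr_eq0 opprK.
Qed.

(** Modulo e5, send e3 to p and e4 to its quarter turn (-p2, p1), both of norm [Q]. With [d] a
    square root of [Q / D], the vector d^2 q is [a] times p plus the quarter turn; the shears along
    e5 absorb [p3] and [q3]. *)
Lemma classify_independent_anisotropic (p1 p2 p3 q1 q2 q3 : F) :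
  p1 * q2 - p2 * q1 != 0 -> p1 ^+ 2 + p2 ^+ 2 != 0 ->
  exists a, isomorphic (type122_alg (v5 0 0 p1 p2 p3) (v5 0 0 q1 q2 q3))
    (model_alg i (Model1 a)).
Proof.
set D := p1 * q2 - p2 * q1; set Q := p1 ^+ 2 + p2 ^+ 2 => D0 Q0.
have [d dd] := closed_sqrt (Q / D).
have d0 : d != 0.
  apply/eqP=> d0; move/eqP: dd; rewrite d0 mul0r eq_sym mulf_eq0 invr_eq0.
  by rewrite (negPf D0) (negPf Q0).
pose a := (p1 * q1 + p2 * q2) / D; exists a.
apply: isomorphic_sym; rewrite model1E.
apply: (@change_iso _ _ _ _ _ _ _ _ _ _ _ _ _ 1 0 0 d p1 p2 p3 (- p2) p1 (d * d * q3 - a * p3) Q).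
rewrite /change_eqs !dd /a /Q; split; split; rewrite ?mul1r ?mul0r ?subr0 //; try by ring.
  by rewrite /D; field.
by rewrite /D; field.
Qed.

Lemma classify_independent_isotropic (p1 p3 q1 q3 : F) :
  p1 != 0 -> q1 != 0 ->
  isomorphic (type122_alg (v5 0 0 p1 (i * p1) p3) (v5 0 0 q1 (- (i * q1)) q3))
    (model_alg i Model6).
Proof.
move=> p0 q0; have [a aa] := closed_sqrt p1^-1; have [d dd] := closed_sqrt q1^-1.
have a0 : a != 0.
  by apply/eqP=> a0; move/eqP: aa; rewrite a0 mul0r eq_sym invr_eq0 (negPf p0).
have d0 : d != 0.
  by apply/eqP=> d0; move/eqP: dd; rewrite d0 mul0r eq_sym invr_eq0 (negPf q0).
apply: isomorphic_sym; rewrite model6E.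
(* [a] and [d] normalise [p1] and [q1] to 1. The shears solve s + i s' = p3 / p1 and s - i s' = q3 /
   q1, which requires dividing by 2. *)
apply: (@change_iso _ _ _ _ _ _ _ _ _ _ _ _ _ a 0 0 d 1 0 ((p3 / p1 + q3 / q1) / 2%:R)
   0 1 ((p3 / p1 - q3 / q1) / (2%:R * i)) 1).
rewrite /change_eqs !aa !dd; split; split; rewrite ?mul0r ?subr0 ?mulf_neq0 ?oner_eq0 //; try by ring.
all: field; rewrite ?p0 ?q0 ?i0 ?two0 //.
Qed.

(* Applied to the e5-component left over when v1 and v2 are scaled to have
   squares that agree modulo e5: scaling by s turns it into e, 0 or 1. *)
Lemma rescaling (x : F) : exists s e : F, [/\ s != 0, x = e * (s * s) & e = 0 \/ e = 1].
Proof.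
have [-> | x0] := eqVneq x 0.
  by exists 1, 0; rewrite oner_eq0 mul0r; split=> //; left.
have [s ss] := closed_sqrt x; exists s, 1; rewrite mul1r ss; split=> //; last by right.
by apply/eqP=> s0; move: x0; rewrite -ss s0 mul0r eqxx.
Qed.

(** Scaling v2 by a square root of 1 / l makes the two squares agree modulo e5, and a shear removes
    the common component [p3]. The remaining difference along e5 is rescaled to 0 or 1, which
    separates families (2) and (3), or (4) and (5) if p is isotropic. *)
Lemma classify_dependent (p1 p2 p3 l q3 : F) :
  (p1 != 0) || (p2 != 0) -> l != 0 ->
  exists m, isomorphic (type122_alg (v5 0 0 p1 p2 p3) (v5 0 0 (l * p1) (l * p2) q3))
    (model_alg i m).
Proof.
move=> p0 l0; have [r rr] := closed_sqrt l^-1.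
have r0 : r != 0.
  by apply/eqP=> r0; move/eqP: rr; rewrite r0 mul0r eq_sym invr_eq0 (negPf l0).
have [Q0 | Q0] := eqVneq (p1 ^+ 2 + p2 ^+ 2) 0.
  have p10 : p1 != 0.
    case: eqP Q0 p0 => //= ->; rewrite expr0n add0r => /eqP.
    by rewrite expf_eq0 => /= ->.
  (* Below, k = s^4 p1^2 and the difference s^2 (q3 / l - p3) has to be e k, whence the denominator.
     In the anisotropic case the norm of p replaces p1^2. *)
  have [s [e [s0 xE e01]]] := rescaling ((q3 / l - p3) / (p1 * p1)).
  have q3E : q3 / l = p3 + e * (s * s) * (p1 * p1).
    by rewrite -xE; field; rewrite l0 p10.
  (* The sign [c] tells which of the two isotropic lines contains p; rescaling e4 by [c] compensates
     for it. *)
  have [c cc p2E] : exists2 c, c * c = 1 & p2 = c * i * p1.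
    have [p2E | p2E] := isotropicP Q0; [exists 1 | exists (-1)]; rewrite ?p2E; ring.
  have iso : isomorphic (type122_alg (v5 0 0 1 i 0) (v5 0 0 1 i e))
    (type122_alg (v5 0 0 p1 p2 p3) (v5 0 0 (l * p1) (l * p2) q3)).
    apply: (@change_iso _ _ _ _ _ _ _ _ _ _ _ _ _ s 0 0 (s * r) (s * s * p1) 0
      (s * s * p3) 0 (c * (s * s * p1)) 0 (s * s * s * s * p1 * p1)).
    have rE x : s * r * (s * r) * x = s * s * (x / l).
      by rewrite -rr; ring.
    split; split; rewrite ?rE ?mul0r ?subr0 ?mulf_neq0 //; rewrite ?q3E ?p2E; try by ring.
    - transitivity (c * c * (s * s * s * s * p1 * p1)); [by ring | by rewrite cc; ring].
    - by field.
    - by field.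
  by case: e01 iso {xE q3E} => -> iso; [exists Model4 | exists Model5];
    apply: isomorphic_sym; rewrite model_coord.
have [s [e [s0 xE e01]]] := rescaling ((q3 / l - p3) / (p1 ^+ 2 + p2 ^+ 2)).
have q3E : q3 / l = p3 + e * (s * s) * (p1 ^+ 2 + p2 ^+ 2).
  by rewrite -xE; field; rewrite l0 Q0.
have iso : isomorphic (type122_alg (v5 0 0 1 0 0) (v5 0 0 1 0 e))
  (type122_alg (v5 0 0 p1 p2 p3) (v5 0 0 (l * p1) (l * p2) q3)).
  apply: (@change_iso _ _ _ _ _ _ _ _ _ _ _ _ _ s 0 0 (s * r) (s * s * p1) (s * s * p2)
    (s * s * p3) (- (s * s * p2)) (s * s * p1) 0 (s * s * s * s * (p1 ^+ 2 + p2 ^+ 2))).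
  have rE x : s * r * (s * r) * x = s * s * (x / l).
    by rewrite -rr; ring.
  split; split; rewrite ?rE ?mul0r ?subr0 ?mulf_neq0 //; rewrite ?q3E; try by ring.
  - by field.
  - by field.
by case: e01 iso {xE q3E} => -> iso; [exists Model2 | exists Model3];
  apply: isomorphic_sym; rewrite model_coord.
Qed.

Lemma proportional (p1 p2 q1 q2 : F) :
  (p1 != 0) || (p2 != 0) -> (q1 != 0) || (q2 != 0) -> p1 * q2 - p2 * q1 = 0 ->
  exists2 l, l != 0 & q1 = l * p1 /\ q2 = l * p2.
Proof.
move=> p0 q0 /eqP; rewrite subr_eq0 => /eqP D.
have [l E] : exists l, q1 = l * p1 /\ q2 = l * p2.
  have [p10 | p10] := eqVneq p1 0; last first.
    by exists (q1 / p1); split; [field | rewrite mulrAC [q1 * _]mulrC -D; field].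
  rewrite p10 eqxx /= in p0; exists (q2 / p2); split; last by field.
  by rewrite p10 mulr0; apply: (mulfI p0); rewrite -D p10; ring.
exists l => //; apply/eqP=> l0; move: q0.
by case: E => -> ->; rewrite l0 !mul0r eqxx.
Qed.

Lemma classify (p1 p2 p3 q1 q2 q3 : F) :
  (p1 != 0) || (p2 != 0) -> (q1 != 0) || (q2 != 0) ->
  exists m, isomorphic (type122_alg (v5 0 0 p1 p2 p3) (v5 0 0 q1 q2 q3)) (model_alg i m).
Proof.
move=> p0 q0; have [D0 | D0] := eqVneq (p1 * q2 - p2 * q1) 0.
  have [l l0 [-> ->]] := proportional p0 q0 D0.
  exact: classify_dependent.
have [Qp | Qp] := eqVneq (p1 ^+ 2 + p2 ^+ 2) 0; last first.
  by have [a] := classify_independent_anisotropic p3 q3 D0 Qp; exists (Model1 a).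
have [Qq | Qq] := eqVneq (q1 ^+ 2 + q2 ^+ 2) 0; last first.
  have D0' : q1 * p2 - q2 * p1 != 0.
    by rewrite -oppr_eq0 opprB [q2 * _]mulrC [q1 * _]mulrC.
  have [a iso] := classify_independent_anisotropic q3 p3 D0' Qq.
  by exists (Model1 a); apply: isomorphic_trans iso; apply: type122_swap.
(* Two isotropic vectors on the same line would be dependent, so p and q lie on different lines, in
   one order or the other. *)
exists Model6; case: (isotropicP Qp) (isotropicP Qq) D0 p0 q0 => -> [] ->.
- by case/eqP; ring.
- move=> _; rewrite oppr_eq0 !mulf_eq0 (negPf i0) /= !orbb => p0 q0.
  exact: classify_independent_isotropic.
- move=> _; rewrite oppr_eq0 !mulf_eq0 (negPf i0) /= !orbb => p0 q0.
  apply: isomorphic_trans (type122_swap _ _ _ _ _ _) _.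
  exact: classify_independent_isotropic.
by case/eqP; ring.
Qed.
End Classify.

(** * Natural bases and the annihilator series *)

Section NaturalBasis.
Variables (F : fieldType) (A : nalg F) (b : seq A).
Hypotheses (bb : basis_of fullv b)
  (orth : forall x y, x \in b -> y \in b -> x != y -> nmul A x y = 0).

Let ub : uniq b. Proof. exact: free_uniq (basis_free bb). Qed.

Lemma mul_natural_basis (c : A -> F) y : y \in b ->
  nmul A (\sum_(x <- b) c x *: x) y = c y *: nmul A y y /\
  nmul A y (\sum_(x <- b) c x *: x) = c y *: nmul A y y.
Proof.
move=> yb; rewrite linear_sumlz linear_sumr.
split; rewrite (big_rem y) //= big_seq big1 ?addr0 => [|x].
- by rewrite linearZl_LR.
- by rewrite mem_rem_uniq // => /andP[/= xy xb]; rewrite linearZl_LR /= orth ?scaler0.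
- by rewrite linearZr_LR.
by rewrite mem_rem_uniq // => /andP[/= xy xb]; rewrite linearZr_LR /= orth ?scaler0 // eq_sym.
Qed.

Lemma natural_basis_expand x : exists c : A -> F, x = \sum_(y <- b) c y *: y.
Proof.
(* Coordinates are indexed by positions; as [b] has no repetition, this sum has a single term when
   [y] is in [b]. *)
exists (fun y => \sum_(j < size b | b`_j == y) coord (in_tuple b) j x).
rewrite {1}(@coord_basis _ _ _ _ (in_tuple b) x bb (memvf x)).
rewrite (big_nth 0) big_mkord; apply: eq_bigr => j _.
by rewrite (big_pred1 j) // => k /=; rewrite nth_uniq.
Qed.

Lemma mem_ann_series y j : y \in b ->
  (y \in ann_series A j.+1) = (nmul A y y \in ann_series A j).
Proof.
move=> yb; apply/idP/idP=> [/ann_seriesP /(_ y)[] // | yy].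
apply/ann_seriesP=> z; have [c ->] := natural_basis_expand z.
by have [-> ->] := mul_natural_basis c yb; rewrite rpredZ.
Qed.

(** If x lies in ann^(j+1), its product with a basis vector y is c(y) y^2 and lies in ann^j; so
    every y occurring in x is itself in ann^(j+1). *)
Lemma ann_series_span j :
  ann_series A j = <<[seq x <- b | x \in ann_series A j]>>%VS.
Proof.
apply/eqP; rewrite eqEsubv; apply/andP; split; last first.
  by apply/span_subvP=> x; rewrite mem_filter => /andP[].
case: j => [|j]; first exact: sub0v.
apply/subvP=> x xj; have [c xE] := natural_basis_expand x.
rewrite xE big_seq rpred_sum // => y yb.
have [-> | c0] := eqVneq (c y) 0; first by rewrite scale0r mem0v.
apply/rpredZ/memv_span; rewrite mem_filter yb andbT mem_ann_series //.
have /ann_seriesP/(_ y)[] := xj.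
by rewrite xE (mul_natural_basis c yb).1 rpredZeq (negPf c0).
Qed.

Lemma dim_ann_series j :
  \dim (ann_series A j) = count [in ann_series A j] b.
Proof.
rewrite {1}ann_series_span -size_filter; apply/eqP.
by have := filter_free [in ann_series A j] (basis_free bb); rewrite /free.
Qed.

End NaturalBasis.

(** The natural basis has 1, 3 and 5 elements in ann^1, ann^2 and ann^3. Its layers are z, then w1,
    w2, then v1, v2, and the layer of a basis vector is decided by where its square lies. *)
Lemma type122_basis (F : fieldType) (A : nalg F) :
  evolution A -> has_type A [:: 1; 2; 2]%N ->
  exists v1 v2 w1 w2 z : A,
    [/\ basis_of fullv [:: v1; v2; w1; w2; z],
        forall x y, x \in [:: v1; v2; w1; w2; z] -> y \in [:: v1; v2; w1; w2; z] ->
          x != y -> nmul A x y = 0,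
        [/\ nmul A v1 v1 \in <<[:: w1; w2; z]>>%VS, nmul A v2 v2 \in <<[:: w1; w2; z]>>%VS,
          nmul A v1 v1 \notin <[z]>%VS & nmul A v2 v2 \notin <[z]>%VS],
        [/\ nmul A w1 w1 \in <[z]>%VS, nmul A w2 w2 \in <[z]>%VS,
          nmul A w1 w1 != 0 & nmul A w2 w2 != 0] &
        nmul A z z = 0].
Proof.
case=> n [e0 [be orth]] [top _ dims].
have {orth}orth x y : x \in e0 -> y \in e0 -> x != y -> nmul A x y = 0.
  move=> /tnthP[j ->] /tnthP[k ->] jk; apply: orth.
  by apply: contraNneq jk => ->.
pose e : seq A := e0; rewrite -[tval e0]/e in be orth.
have dimA := dim_ann_series be orth.
set P1 := [in ann_series A 1]; set P2 := [in ann_series A 2].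
have P12 x : P1 x -> P2 x by apply/subvP/ann_seriesS.
have [c1 c2 c3] : [/\ count P1 e = 1, count P2 e = 3 & size e = 5]%N.
  have d0 : \dim (ann_series A 0) = 0%N by rewrite dimv0.
  have d3 : \dim (ann_series A 3) = size e.
    by rewrite [ann_series A 3]top -(size_basis (be : basis_of fullv (in_tuple e))).
  have d1 : 1%N = (count P1 e - 0)%N.
    by rewrite -[0%N in RHS]d0 -(dimA 1%N); exact: dims 0%N isT.
  have d2 : 2%N = (count P2 e - count P1 e)%N.
    by rewrite -(dimA 1%N) -(dimA 2%N); exact: dims 1%N isT.
  have d3' : 2%N = (size e - count P2 e)%N.
    by rewrite -(dimA 2%N) -d3; exact: dims 2%N isT.
  (* These subtractions are truncated, but their values are positive and so determine the counts. *)
  by move: d1 d2 d3'; clear; move: (count P1 e) (count P2 e) (size e) => a b c; split; lia.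
pose e1 := filter P1 e; pose e2 := filter P2 (filter (predC P1) e).
pose e3 := filter (predC P2) (filter (predC P1) e).
have pe : perm_eq (e3 ++ e2 ++ e1) e.
  rewrite -(permPr (permEl (perm_filterC P1 e))) catA perm_catC perm_cat2l perm_catC.
  exact/permEl/perm_filterC.
have cP1 : count (predI P1 P2) e = 1%N.
  by rewrite -c1; apply: eq_count => x /=; case P1x: (P1 x) => //=; rewrite P12.
have s1 : size e1 = 1%N by rewrite size_filter.
have s2 : size e2 = 2%N.
  rewrite size_filter count_filter; have := count_predC P1 (filter P2 e).
  rewrite !count_filter size_filter cP1 c2.
  rewrite (@eq_count _ (predI (predC P1) P2) (predI P2 (predC P1))); first by case.
  by move=> x; rewrite /= andbC.
have s3 : size e3 = 2%N by move/perm_size: pe; rewrite !size_cat s1 s2 c3 addn3; case.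
have in1 x : x \in e1 -> (x \in e) && P1 x by rewrite mem_filter andbC.
have in2 x : x \in e2 -> [&& x \in e, P2 x & ~~ P1 x].
  by rewrite !mem_filter => /and3P[-> ? ->].
have in3 x : x \in e3 -> (x \in e) && ~~ P2 x.
  by rewrite !mem_filter => /and3P[/= P2x _ ->].
clearbody e1 e2 e3; move: s1 s2 s3 in1 in2 in3 pe.
case: e1 => [|z []] // _; case: e2 => [|w1 [|w2 []]] // _; case: e3 => [|v1 [|v2 []]] // _.
move=> in1 in2 in3 pe.
set b := ([:: v1; v2] ++ [:: w1; w2] ++ [:: z]) in pe.
have bb : basis_of fullv b by rewrite (perm_basis _ pe).
have orthb x y : x \in b -> y \in b -> x != y -> nmul A x y = 0.
  by rewrite !(perm_mem pe); apply: orth.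
have /andP[_ z1] := (in1 z (mem_head _ _)).
have /and3P[_ w12 w11] := in2 w1 (mem_head _ _).
have /and3P[_ w22 w21] := in2 w2 (mem_last w1 [:: w2]).
have /andP[_ v12] := in3 v1 (mem_head _ _).
have /andP[_ v22] := in3 v2 (mem_last v1 [:: v2]).
have [v11 v21] : ~~ P1 v1 /\ ~~ P1 v2 by split; [apply: contra v12 | apply: contra v22]; apply: P12.
have ann1E : ann_series A 1 = <[z]>%VS.
  rewrite (ann_series_span bb orthb) -span_seq1 /b; congr span.
  by move: v11 v21 w11 w21 z1; rewrite /P1 /= => /negPf-> /negPf-> /negPf-> /negPf-> ->.
have ann2E : ann_series A 2 = <<[:: w1; w2; z]>>%VS.
  rewrite (ann_series_span bb orthb) /b; congr span.
  by move: v12 v22 w12 w22 (P12 _ z1); rewrite /P2 /= => /negPf-> /negPf-> -> -> ->.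
have sqb := mem_ann_series bb orthb.
have ann3 x : x \in ann_series A 3 by rewrite [ann_series A 3]top memvf.
have [bv1 bv2 bw1 bw2 bz] : [/\ v1 \in b, v2 \in b, w1 \in b, w2 \in b & z \in b].
  by split; rewrite !inE eqxx ?orbT.
exists v1, v2, w1, w2, z; split=> //.
(* v1 and v2 lie in ann^3 but not in ann^2, so their squares lie in ann^2 but not in ann^1. *)
- move: (sqb v1 2%N bv1) (sqb v2 2%N bv2) (sqb v1 1%N bv1) (sqb v2 1%N bv2).
  move: v12 v22; rewrite /P2 ann1E ann2E !ann3 => v12 v22 <- <- <- <-.
  by split.
- rewrite -ann1E -!memv0 -[0%VS]/(ann_series A 0).
  by rewrite -!(sqb _ _ bw1) -!(sqb _ _ bw2); split.
by apply/eqP; rewrite -memv0 -[0%VS]/(ann_series A 0) -sqb.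
Qed.

(** Dividing w1 and w2 by square roots of the coefficients of their squares makes both squares equal
    to z; p and q are then the coordinates of v1^2 and v2^2. *)
Lemma type122_isomorphic (F : closedFieldType) (A : nalg F) :
  evolution A -> has_type A [:: 1; 2; 2]%N ->
  exists p1 p2 p3 q1 q2 q3 : F,
    [/\ (p1 != 0) || (p2 != 0), (q1 != 0) || (q2 != 0) &
      isomorphic A (type122_alg (v5 0 0 p1 p2 p3) (v5 0 0 q1 q2 q3))].
Proof.
move=> evA tyA.
have [v1 [v2 [w1 [w2 [z [bb orth [V1 V2 V1z V2z] [W1 W2 W10 W20] Z]]]]]] := type122_basis evA tyA.
have [c1 E1] := vlineP _ _ W1; have [c2 E2] := vlineP _ _ W2.
have c10 : c1 != 0 by apply: contraNneq W10 => c0; rewrite E1 c0 scale0r.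
have c20 : c2 != 0 by apply: contraNneq W20 => c0; rewrite E2 c0 scale0r.
have [r1 R1] := closed_sqrt c1; have [r2 R2] := closed_sqrt c2.
have r10 : r1 != 0 by apply: contraNneq c10 => r0; rewrite -R1 r0 mul0r.
have r20 : r2 != 0 by apply: contraNneq c20 => r0; rewrite -R2 r0 mul0r.
pose x1 := r1^-1 *: w1; pose x2 := r2^-1 *: w2.
have wx1 : w1 = r1 *: x1 by rewrite scalerA mulfV ?scale1r.
have wx2 : w2 = r2 *: x2 by rewrite scalerA mulfV ?scale1r.
have expand v : v \in <<[:: w1; w2; z]>>%VS -> v \notin <[z]>%VS ->
    exists a b c, (a != 0) || (b != 0) /\ v = a *: x1 + b *: x2 + c *: z.
  rewrite !span_cons span_nil addv0.
  move=> /memv_addP[_ /vlineP[a ->] [_ /memv_addP[_ /vlineP[b ->] [_ /vlineP[c ->] ->]] ->]].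
  rewrite addrA => nz; exists (a * r1), (b * r2), c.
  split; last by rewrite -!scalerA -wx1 -wx2.
  rewrite !mulf_eq0 (negPf r10) (negPf r20) !orbF -negb_and.
  apply: contra nz => /andP[/eqP-> /eqP->].
  by rewrite !scale0r !add0r memvZ ?memv_line.
have [p1 [p2 [p3 [p0 P]]]] := expand _ V1 V1z.
have [q1 [q2 [q3 [q0 Q]]]] := expand _ V2 V2z.
exists p1, p2, p3, q1, q2, q3; split=> //.
pose b := [tuple v1; v2; x1; x2; z].
have nb : natural_basis b.
  split.
    have d5 : \dim (fullv : {vspace A}) = 5%N.
      exact: size_basis (bb : basis_of fullv [tuple v1; v2; w1; w2; z]).
    rewrite basisEdim d5 andbT -(span_basis bb).
    apply/span_subvP=> x; rewrite !inE => /or4P[|||/orP[]] /eqP->;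
      rewrite ?wx1 ?wx2; try apply: memvZ; by apply: memv_span; rewrite !inE eqxx ?orbT.
  have ub := free_uniq (basis_free bb).
  (* The new basis is the old one up to these scalars, so it inherits orthogonality. *)
  pose s (j : 'I_5) := nth 0 [:: 1; 1; r1^-1; r2^-1; 1] j.
  have bE (j : 'I_5) : tnth b j = s j *: nth 0 [:: v1; v2; w1; w2; z] j.
    by case: j => -[|[|[|[|[|j]]]]] // lt5; rewrite (tnth_nth 0) /s /= ?scale1r.
  move=> j k jk; rewrite !bE linearZl_LR linearZr_LR /= orth ?scaler0 ?mem_nth //.
  by rewrite nth_uniq.
apply: (@iso_of_squares _ _ _ b); first exact: nb.
case=> -[|[|[|[|[|j]]]]] // lt5; rewrite !(tnth_nth 0) /= !big_ord_recl big_ord0.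
all: rewrite ?e_v5 !mxE ?(tnth_nth 0) /= ?scale0r ?scale1r ?add0r ?addr0 //.
- by rewrite P addrA.
- by rewrite Q addrA.
- by rewrite linearZl_LR linearZr_LR /= E1 !scalerA -R1 -[RHS]scale1r; congr (_ *: _); field.
by rewrite linearZl_LR linearZr_LR /= E2 !scalerA -R2 -[RHS]scale1r; congr (_ *: _); field.
Qed.

(** * Invariants separating the families *)

Section Separate.
Variables (F : fieldType).

(** With M the block on e3, e4: det(p, q) det M = (a^2 d^2 - b^2 c^2) det(p', q'), and det M is
    nonzero by Lagrange's identity. *)
Lemma iso_dependent (p1 p2 p3 q1 q2 q3 p1' p2' p3' q1' q2' q3' : F) :
  (p1' != 0) || (p2' != 0) -> (q1' != 0) || (q2' != 0) ->
  isomorphic (type122_alg (v5 0 0 p1 p2 p3) (v5 0 0 q1 q2 q3))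
    (type122_alg (v5 0 0 p1' p2' p3') (v5 0 0 q1' q2' q3')) ->
  p1' * q2' - p2' * q1' = 0 -> p1 * q2 - p2 * q1 = 0.
Proof.
move=> p0 q0 /(iso_change p0 q0)[a [b [c [d [m [n [s [m' [n' [s' [k]]]]]]]]]]].
case=> -[_ k0 mm mm' mn] _ [P1 P2 _] [Q1 Q2 _] D.
have : (p1 * q2 - p2 * q1) * (m * n' - n * m') = 0.
  transitivity ((p1 * m + p2 * m') * (q1 * n + q2 * n') - (p1 * n + p2 * n') * (q1 * m + q2 * m')).
    by ring.
  rewrite P1 P2 Q1 Q2.
  by transitivity ((a * a * (d * d) - b * b * (c * c)) * (p1' * q2' - p2' * q1')); [ring | rewrite D mulr0].
move/eqP; rewrite mulf_eq0 => /orP[/eqP // | /eqP d0].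
case/eqP: k0; have /eqP : k * k = 0; last by rewrite mulf_eq0 orbb => /eqP.
rewrite -{1}mm -mm'; transitivity ((m * n' - n * m') ^+ 2 + (m * m' + n * n') ^+ 2); first by ring.
by rewrite d0 mn; ring.
Qed.

(** Modulo e5, p maps to (a^2 + b^2) p', while norms are multiplied by [k]. *)
Lemma iso_isotropic_dependent (p1 p2 p3 q3 p1' p2' p3' q3' : F) :
  (p1' != 0) || (p2' != 0) ->
  isomorphic (type122_alg (v5 0 0 p1 p2 p3) (v5 0 0 p1 p2 q3))
    (type122_alg (v5 0 0 p1' p2' p3') (v5 0 0 p1' p2' q3')) ->
  p1' ^+ 2 + p2' ^+ 2 = 0 -> p1 ^+ 2 + p2 ^+ 2 = 0.
Proof.
move=> p0 /(iso_change p0 p0)[a [b [c [d [m [n [s [m' [n' [s' [k]]]]]]]]]]].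
case=> -[_ k0 mm mm' mn] _ [P1 P2 _] [Q1 Q2 _] D.
apply: (mulIf k0); rewrite mul0r.
transitivity ((p1 * m + p2 * m') ^+ 2 + (p1 * n + p2 * n') ^+ 2).
  transitivity (p1 ^+ 2 * (m * m + n * n) + p2 ^+ 2 * (m' * m' + n' * n') +
                2%:R * p1 * p2 * (m * m' + n * n')); last by ring.
  by rewrite mm mm' mn; ring.
rewrite P1 P2.
transitivity ((a * a + b * b) ^+ 2 * (p1' ^+ 2 + p2' ^+ 2)); first by ring.
by rewrite D mulr0.
Qed.

(** Along e5, equality of e1^2 and e2^2 in the source gives b^2 = d^2, and e1 e2 = 0 gives b d = 0.
    So b = d = 0, against invertibility. *)
Lemma not_iso_equal_squares (p1 p2 p1' p2' : F) :
  (p1' != 0) || (p2' != 0) ->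
  ~ isomorphic (type122_alg (v5 0 0 p1 p2 0) (v5 0 0 p1 p2 0))
    (type122_alg (v5 0 0 p1' p2' 0) (v5 0 0 p1' p2' 1)).
Proof.
move=> p0 /(iso_change p0 p0)[a [b [c [d [m [n [s [m' [n' [s' [k]]]]]]]]]]].
case=> -[det0 k0 _ _ _] [_ _ O] [_ _ P] [_ _ Q].
have bd : b * d = 0 by rewrite -O; ring.
have bbdd : b * b = d * d.
  by transitivity (a * a * 0 + b * b * 1); [ring | rewrite -P Q; ring].
have b0 : b = 0.
  have /eqP : (b * b) * (b * b) = 0.
    by rewrite {2}bbdd; transitivity ((b * d) ^+ 2); [ring | rewrite bd; ring].
  by rewrite !mulf_eq0 !orbb => /eqP.
have d0 : d = 0.
  by move/eqP: bbdd; rewrite b0 mul0r eq_sym mulf_eq0 orbb => /eqP.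
by case/eqP: det0; rewrite b0 d0; ring.
Qed.

(** Independence of the target squares turns e1 e2 = 0 into a c = b d = 0, whence a b = 0. So e1^2 =
    e3, of norm 1, would map modulo e5 to a multiple of an isotropic vector. *)
Lemma not_iso_both_isotropic (a0 p1 p2 q1 q2 p3 q3 : F) :
  p1 ^+ 2 + p2 ^+ 2 = 0 -> q1 ^+ 2 + q2 ^+ 2 = 0 -> p1 * q2 - p2 * q1 != 0 ->
  ~ isomorphic (type122_alg (v5 0 0 1 0 0) (v5 0 0 a0 1 0))
      (type122_alg (v5 0 0 p1 p2 p3) (v5 0 0 q1 q2 q3)).
Proof.
move=> Qp Qq D0.
have p0 : (p1 != 0) || (p2 != 0).
  by rewrite -negb_and; apply: contra D0 => /andP[/eqP-> /eqP->]; rewrite !mul0r subrr.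
have q0 : (q1 != 0) || (q2 != 0).
  by rewrite -negb_and; apply: contra D0 => /andP[/eqP-> /eqP->]; rewrite !mulr0 subrr.
move=> /(iso_change p0 q0)[a [b [c [d [m [n [s [m' [n' [s' [k]]]]]]]]]]].
case=> -[det0 k0 mm _ _] [O1 O2 _] [P1 P2 _] _.
have ac : a * c = 0.
  apply: (mulIf D0); rewrite mul0r.
  transitivity ((a * c * p1 + b * d * q1) * q2 - (a * c * p2 + b * d * q2) * q1); first by ring.
  by rewrite O1 O2; ring.
have bd : b * d = 0.
  apply: (mulIf D0); rewrite mul0r.
  transitivity ((a * c * p2 + b * d * q2) * p1 - (a * c * p1 + b * d * q1) * p2); first by ring.
  by rewrite O1 O2; ring.
have ab : a * b = 0.
  apply: (mulIf det0); rewrite mul0r.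
  by transitivity (a * a * (b * d) - b * b * (a * c)); [ring | rewrite ac bd; ring].
case/eqP: k0; rewrite -mm.
have -> : m = a * a * p1 + b * b * q1 by rewrite -P1; ring.
have -> : n = a * a * p2 + b * b * q2 by rewrite -P2; ring.
transitivity (a ^+ 4 * (p1 ^+ 2 + p2 ^+ 2) + b ^+ 4 * (q1 ^+ 2 + q2 ^+ 2)
   + (a * b) ^+ 2 * 2%:R * (p1 * q1 + p2 * q2)); first by ring.
by rewrite Qp Qq ab; ring.
Qed.

(** As a c = b d = 0, the isomorphism either preserves the lines of e1 and e2 or exchanges them; in
    each case norms and inner products of the two squares are compared. *)
Lemma iso_model1_sqr (x x' : F) :
  isomorphic (type122_alg (v5 0 0 1 0 0) (v5 0 0 x 1 0))
    (type122_alg (v5 0 0 1 0 0) (v5 0 0 x' 1 0)) -> x' ^+ 2 = x ^+ 2.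
Proof.
have p0 : ((1 : F) != 0) || ((0 : F) != 0) by rewrite oner_eq0.
have q0 : (x' != 0) || ((1 : F) != 0) by rewrite oner_eq0 orbT.
move=> /(iso_change p0 q0)[a [b [c [d [m [n [s [m' [n' [s' [k]]]]]]]]]]].
case=> -[det0 k0 mm mm' mn] [O1 O2 _] [P1 P2 _] [Q1 Q2 _].
have bd : b * d = 0 by rewrite -O2; ring.
have ac : a * c = 0 by rewrite -O1 bd; ring.
have mE : m = a * a + b * b * x' by transitivity (a * a * 1 + b * b * x'); [rewrite -P1; ring | ring].
have nE : n = b * b by transitivity (a * a * 0 + b * b * 1); [rewrite -P2; ring | ring].
have m'E : m' = c * c + d * d * x' - x * m.
  by transitivity (c * c * 1 + d * d * x' - x * m); [rewrite -Q1; ring | ring].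
have n'E : n' = d * d - x * n.
  by transitivity (c * c * 0 + d * d * 1 - x * n); [rewrite -Q2; ring | ring].
(* Lines preserved: then e4 maps along e4 modulo e5, a^4 = d^4 = k, and x a^2 = d^2 x' is
   squared. *)
have [b0 | b0] := eqVneq b 0.
  have a0 : a != 0 by apply: contraNneq det0 => a0; rewrite a0 b0; apply/eqP; ring.
  have c0 : c = 0 by apply: (mulfI a0); rewrite ac mulr0.
  have {}mE : m = a * a by rewrite mE b0; ring.
  have {}nE : n = 0 by rewrite nE b0; ring.
  have kE : k = a ^+ 4 by rewrite -mm mE nE; ring.
  have m'0 : m' = 0.
    apply: (mulfI (_ : m != 0)); first by rewrite mE mulf_neq0.
    by rewrite mulr0 -mn nE; ring.
  have {}n'E : n' = d * d by rewrite n'E nE; ring.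
  have dk : d ^+ 4 = k by rewrite -mm' m'0 n'E; ring.
  have E : x * (a * a) = d * d * x'.
    by apply/eqP; rewrite -subr_eq0 -oppr_eq0; apply/eqP; rewrite -m'0 m'E mE c0; ring.
  apply: (mulfI k0); rewrite -{1}dk {1}kE.
  transitivity ((d * d * x') ^+ 2); first by ring.
  by rewrite -E; ring.
(* Lines exchanged: [kE] comes from the norm of e1^2, [E1] from the inner product of e1^2 and e2^2,
   [E2] from the norm of e2^2. *)
have d0 : d = 0 by apply: (mulfI b0); rewrite bd mulr0.
have c0 : c != 0 by apply: contraNneq det0 => c0; rewrite c0 d0; apply/eqP; ring.
have a0 : a = 0 by apply: (mulIf c0); rewrite ac mul0r.
have bb0 : b * b != 0 by rewrite mulf_neq0.
rewrite a0 d0 in mE m'E n'E.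
have kE : k = b ^+ 4 * (x' ^+ 2 + 1) by rewrite -mm mE nE; ring.
have E1 : x' * (c * c) = x * (b * b) * (x' ^+ 2 + 1).
  apply/eqP; rewrite -subr_eq0; apply/eqP; apply: (mulfI bb0); rewrite mulr0 -mn.
  by rewrite mE nE m'E n'E mE nE; ring.
have E2 : c ^+ 4 = k * (1 + x ^+ 2).
  transitivity (k + 2%:R * (x * (b * b)) * (x' * (c * c)) - (x * (b * b)) ^+ 2 * (x' ^+ 2 + 1)).
    by rewrite -{1}mm' m'E n'E mE nE; ring.
  by rewrite E1 kE; ring.
suff : x' ^+ 2 * (1 + x ^+ 2) = x ^+ 2 * (x' ^+ 2 + 1).
  by rewrite !mulrDr !mulr1 [X in _ = X + _]mulrC addrC => /addrI.
apply: (mulfI k0); transitivity ((x' * (c * c)) ^+ 2).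
  by transitivity (x' ^+ 2 * (k * (1 + x ^+ 2))); [ring | rewrite -E2; ring].
by rewrite E1 kE; ring.
Qed.
End Separate.

Lemma iso_model1 (F : fieldType) (i a a' : F) : i ^+ 2 = -1 ->
  isomorphic (model_alg i (Model1 a)) (model_alg i (Model1 a')) <->
    a' = a \/ a' = - a.
Proof.
move=> i2; rewrite !model1E; split=> [/iso_model1_sqr /eqP | aE].
  by rewrite eqf_sqr => /orP[] /eqP->; [left | right].
have ii : i * i = -1 by rewrite -expr2.
have i0 : i != 0 by apply: contra_eq_neq ii => ->; rewrite mul0r eq_sym oppr_eq0 oner_eq0.
case: aE => ->.
  apply: (@change_iso _ _ _ _ _ _ _ _ _ _ _ _ _ 1 0 0 1 1 0 0 0 1 0 1).
  by split; split; rewrite ?mul1r ?mul0r ?subr0 ?oner_eq0 //; ring.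
(* The sign of the parameter is reversed by e2 |-> i e2 and e4 |-> - e4. *)
apply: (@change_iso _ _ _ _ _ _ _ _ _ _ _ _ _ 1 0 0 i 1 0 0 0 (-1) 0 1).
by rewrite /change_eqs !ii; split; split; rewrite ?mul1r ?mul0r ?subr0 ?oner_eq0 //; ring.
Qed.

Theorem theorem6p5 (F : closedFieldType) (char2 : 2%N \notin [pchar F])
    (i : F) (i2 : i ^+ 2 = -1) :
  [/\ forall E : nalg F,
        evolution E -> nilpotent E -> has_type E [:: 1; 2; 2]%N ->
        exists m : model F, isomorphic E (model_alg i m),
      forall m m' : model F, model_family m <> model_family m' ->
        ~ isomorphic (model_alg i m) (model_alg i m') &
      forall a a' : F,
        isomorphic (model_alg i (Model1 a)) (model_alg i (Model1 a')) <->
        (a' = a \/ a' = - a)].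
Proof.
split; last by move=> a a'; apply: iso_model1.
  move=> E evE _ tyE; have [p1 [p2 [p3 [q1 [q2 [q3 [p0 q0 iso]]]]]]] := type122_isomorphic evE tyE.
  have [m iso'] := classify char2 i2 p3 q3 p0 q0.
  by exists m; apply: isomorphic_trans iso'.
have two0 : 2%:R != 0 :> F by move: char2; rewrite inE.
have i0 : i != 0.
  by apply: contra_eq_neq i2 => ->; rewrite expr0n eq_sym oppr_eq0 oner_eq0.
have n1 (x : F) : ((1 : F) != 0) || (x != 0) by rewrite oner_eq0.
have det_dep (x : F) : 1 * x - x * 1 = 0 by ring.
(* The value is -2i: characteristic not two keeps the two isotropic lines apart. *)
have det6 : 1 * - i - i * 1 != 0.
  by rewrite (_ : _ - _ = - (2%:R * i)); [rewrite oppr_eq0 mulf_neq0 | ring].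
have det1 (a : F) : 1 * 1 - 0 * a = 1 by ring.
have iso0 : (1 : F) ^+ 2 + i ^+ 2 = 0 by rewrite i2; ring.
have iso0' : (1 : F) ^+ 2 + (- i) ^+ 2 = 0 by rewrite sqrrN.
have aniso : (1 : F) ^+ 2 + 0 ^+ 2 != 0.
  by rewrite (_ : _ + _ = 1); [rewrite oner_eq0 | ring].
pose R m m' := isomorphic (model_alg i m) (model_alg i m').
suff: forall m m', model_family m <> model_family m' -> ~ R m m' by [].
have Rsym m m' : R m m' -> R m' m by apply: isomorphic_sym.
have indep_dep m m' : model_family m \in [:: 1; 6]%N -> model_family m' \in [:: 2; 3; 4; 5]%N ->
    ~ R m m'.
  by case: m => [a|||||] //; case: m' => [a'|||||] // _ _; rewrite /R !model_coord;
    move=> /(iso_dependent (n1 _) (n1 _))/(_ (det_dep _))/eqP;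
    rewrite ?det1 ?oner_eq0 ?(negPf det6).
have aniso_iso m m' : model_family m \in [:: 2; 3]%N -> model_family m' \in [:: 4; 5]%N ->
    ~ R m m'.
  by case: m => [a|||||] //; case: m' => [a'|||||] // _ _; rewrite /R !model_coord;
    move=> /(iso_isotropic_dependent (n1 _))/(_ iso0)/eqP; rewrite (negPf aniso).
have not16 a : ~ R (Model1 a) Model6.
  by rewrite /R !model_coord; apply: not_iso_both_isotropic.
have not23 : ~ R Model2 Model3.
  by rewrite /R !model_coord; apply: not_iso_equal_squares.
have not45 : ~ R Model4 Model5.
  by rewrite /R !model_coord; apply: not_iso_equal_squares.
clearbody R => m m' neq; wlog lt : m m' neq / (model_family m < model_family m')%N.
  move=> th; move/eqP: (neq); rewrite neq_ltn => /orP[] lt; first exact: th.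
  by move/Rsym; apply: th lt => eq; apply: neq.
case: m lt {neq} => [a|||||]; case: m' => [a'|||||] // _.
all: try by [apply: indep_dep | apply: aniso_iso].
(* A dependent family against (6): here the numbering is opposite to the order in [indep_dep]. *)
all: by move/Rsym; apply: indep_dep.
Qed.
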